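(* Let $k_1,k_2\ge1$ be integers, $a,b,c_1,c_2\in\mathbb{C}$, and $t_1,t_2$ complex variables. Put $D_1=\frac{1}{k_1}\Theta_{t_1}$ and $D_2=\frac{1}{k_2}\Theta_{t_2}$. Write $F=\mathcal{F}^{(1)}_4(a,b;c_1,c_2;t_1,t_2,k_1,k_2,x,y)$, and let $F(a\pm1)$, $F(b\pm1)$, $F(c_1\pm1)$, $F(c_2\pm1)$ denote the function obtained from $F$ by changing only the indicated parameter by $\pm1$. Then the following difference recursion relations hold: 1. $a(a-1)F(a+1)-(a+D_1+D_2)(a+D_1+D_2-1)F(a-1)=0$; 2. $a(b-1)F(a+1)-(a+D_1+D_2)(b+D_1+D_2-1)F(b-1)=0$; 3. $a\,c_1F(a+1)-(a+D_1+D_2)(c_1+D_1)F(c_1+1)=0$; 4. $a\,c_2F(a+1)-(a+D_1+D_2)(c_2+D_2)F(c_2+1)=0$; 5. $a(b+D_1+D_2)F(a+1)-b(a+D_1+D_2)F(b+1)=0$; 6. $a(c_1+D_1-1)F(a+1)-(c_1-1)(a+D_1+D_2)F(c_1-1)=0$; 7. $a(c_2+D_2-1)F(a+1)-(c_2-1)(a+D_1+D_2)F(c_2-1)=0$; 8. $(a+D_1+D_2-1)(b+D_1+D_2)F(a-1)-b(a-1)F(b+1)=0$; 9. $(a+D_1+D_2-1)(c_1+D_1-1)F(a-1)-(c_1-1)(a-1)F(c_1-1)=0$; 10. $(a+D_1+D_2-1)(c_2+D_2-1)F(a-1)-(c_2-1)(a-1)F(c_2-1)=0$; 11. $(b-1)(a+D_1+D_2-1)F(a-1)-(a-1)(b+D_1+D_2-1)F(b-1)=0$;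 12. $c_1(a+D_1+D_2-1)F(a-1)-(a-1)(c_1+D_1)F(c_1+1)=0$; 13. $c_2(a+D_1+D_2-1)F(a-1)-(a-1)(c_2+D_2)F(c_2+1)=0$; 14. $b(b-1)F(b+1)-(b+D_1+D_2)(b+D_1+D_2-1)F(b-1)=0$; 15. $b(c_1+D_1-1)F(b+1)-(c_1-1)(b+D_1+D_2)F(c_1-1)=0$; 16. $b(c_2+D_2-1)F(b+1)-(c_2-1)(b+D_1+D_2)F(c_2-1)=0$; 17. $b\,c_1F(b+1)-(c_1+D_1)(b+D_1+D_2)F(c_1+1)=0$; 18. $b\,c_2F(b+1)-(c_2+D_2)(b+D_1+D_2)F(c_2+1)=0$; 19. $(b+D_1+D_2-1)(c_1+D_1-1)F(b-1)-(c_1-1)(b-1)F(c_1-1)=0$; 20. $(b+D_1+D_2-1)(c_2+D_2-1)F(b-1)-(c_2-1)(b-1)F(c_2-1)=0$; 21. $c_1(b+D_1+D_2-1)F(b-1)-(b-1)(c_1+D_1)F(c_1+1)=0$; 22. $c_2(b+D_1+D_2-1)F(b-1)-(b-1)(c_2+D_2)F(c_2+1)=0$; 23. $c_1(c_1-1)F(c_1-1)-(c_1+D_1-1)(c_1+D_1)F(c_1+1)=0$; 24. $(c_1-1)(c_2+D_2-1)F(c_1-1)-(c_2-1)(c_1+D_1-1)F(c_2-1)=0$; 25. $c_2(c_1-1)F(c_1-1)-(c_1+D_1-1)(c_2+D_2)F(c_2+1)=0$; 26. $(c_1+D_1)(c_2+D_2-1)F(c_1+1)-c_1(c_2-1)F(c_2-1)=0$;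 27. $c_2(c_1+D_1)F(c_1+1)-c_1(c_2+D_2)F(c_2+1)=0$; 28. $c_2(c_2-1)F(c_2-1)-(c_2+D_2-1)(c_2+D_2)F(c_2+1)=0$.
   Context: For $a\in\mathbb{C}$ the shifted factorial is $(a)_0=1$ and $(a)_l=a(a+1)\cdots(a+l-1)$ for $l\ge1$. For complex $a,b,c_1,c_2,t_1,t_2$ and natural numbers $k_1,k_2$, the first discrete Appell function is $$\mathcal{F}^{(1)}_4(a,b;c_1,c_2;t_1,t_2,k_1,k_2,x,y)=\sum_{m,n\ge0}\frac{(a)_{m+n}(b)_{m+n}(-1)^{mk_1}(-t_1)_{mk_1}(-1)^{nk_2}(-t_2)_{nk_2}}{(c_1)_m(c_2)_n\,m!\,n!}\,x^my^n.$$ In every function $\mathcal{F}^{(1)}_4$ that appears, the real parts of the two lower parameters are assumed different from $0,-1,-2,\dots$. The series is regarded as an absolutely convergent function of its last two arguments $x,y$ in the region $\sqrt{|x|}+\sqrt{|y|}<1$. For a function $f$ of $t$: $\Delta_tf(t)=f(t+1)-f(t)$, $\rho_tf(t)=f(t-1)$, and $\Theta_t=t\,\rho_t\,\Delta_t$, i.e. $\Theta_tf(t)=t\,(f(t)-f(t-1))$. Scalars in operator expressions act by multiplication. *)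

(* Defs.v *)
From Stdlib Require Import Reals Factorial.
From Coquelicot Require Import Coquelicot.

Open Scope C_scope.

Fixpoint poch (a : C) (l : nat) : C :=
  match l with
  | O => 1
  | S l' => poch a l' * (a + INR l')
  end.

(* Double series over nat x nat. For an absolutely convergent series the limit
   of the square partial sums is the sum in any order of summation;
   [double_sum] carries no meaning for other series. *)
Definition box_sum {G : AbelianMonoid} (u : nat -> nat -> G) (N : nat) : G :=
  sum_n (fun m => sum_n (fun n => u m n) N) N.

Definition abs_summable (u : nat -> nat -> C) : Prop :=
  ex_finite_lim_seq (box_sum (fun m n => Cmod (u m n))).

Definition double_sum (u : nat -> nat -> C) : C :=
  (real (Lim_seq (fun N => Re (box_sum u N))),
   real (Lim_seq (fun N => Im (box_sum u N)))).

Definition appell4_term (a b c1 c2 t1 t2 : C) (k1 k2 : nat) (x y : C)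
    (m n : nat) : C :=
  (poch a (m + n) * poch b (m + n)
     * ((-1) ^ (m * k1) * poch (- t1) (m * k1))
     * ((-1) ^ (n * k2) * poch (- t2) (n * k2)))
  / (poch c1 m * poch c2 n * INR (fact m) * INR (fact n))
  * x ^ m * y ^ n.

Definition appell4 (a b c1 c2 t1 t2 : C) (k1 k2 : nat) (x y : C) : C :=
  double_sum (appell4_term a b c1 c2 t1 t2 k1 k2 x y).

Definition region (x y : C) : Prop := (sqrt (Cmod x) + sqrt (Cmod y) < 1)%R.

Definition lower_ok (c : C) : Prop := forall n : nat, Re c <> (- INR n)%R.

(* The standing assumptions on a function that appears. Absolute convergence in
   the region has to be assumed: for k1, k2 >= 1 it holds e.g. when t1 and t2
   are natural numbers, or when a or b is a non-positive integer, but it fails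
   for generic parameters. It is required at the unshifted point (t1, t2) only. *)
Definition well_defined (a b c1 c2 t1 t2 : C) (k1 k2 : nat) : Prop :=
  lower_ok c1 /\ lower_ok c2 /\
  forall x y : C, region x y ->
    abs_summable (appell4_term a b c1 c2 t1 t2 k1 k2 x y).

(* Operators on functions of (t1, t2). *)
Definition operator := (C -> C -> C) -> C -> C -> C.

Declare Scope op_scope.
Delimit Scope op_scope with op.
Bind Scope op_scope with operator.

Definition sc (z : C) : operator := fun f t1 t2 => z * f t1 t2.
Arguments sc z%_C_scope.
Definition op_add (A B : operator) : operator :=
  fun f t1 t2 => A f t1 t2 + B f t1 t2.
Definition op_sub (A B : operator) : operator :=
  fun f t1 t2 => A f t1 t2 - B f t1 t2.
Definition op_comp (A B : operator) : operator := fun f => A (B f).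

Notation "A + B" := (op_add A B) : op_scope.
Notation "A - B" := (op_sub A B) : op_scope.
Notation "A * B" := (op_comp A B) : op_scope.

Definition Delta1 : operator := fun f t1 t2 => f (t1 + 1) t2 - f t1 t2.
Definition Delta2 : operator := fun f t1 t2 => f t1 (t2 + 1) - f t1 t2.
Definition rho1 : operator := fun f t1 t2 => f (t1 - 1) t2.
Definition rho2 : operator := fun f t1 t2 => f t1 (t2 - 1).
Definition mul_t1 : operator := fun f t1 t2 => t1 * f t1 t2.
Definition mul_t2 : operator := fun f t1 t2 => t2 * f t1 t2.
Definition Theta1 : operator := (mul_t1 * rho1 * Delta1)%op.
Definition Theta2 : operator := (mul_t2 * rho2 * Delta2)%op.

Record params := Params { pa : C; pb : C; pc1 : C; pc2 : C }.
Arguments Params (pa pb pc1 pc2)%_C_scope.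

(* A F(p) - B F(q) = 0 at (t1, t2), where F(p) has parameters p, as soon as both
   F(p) and F(q) satisfy the standing assumptions. *)
Definition relation_at (k1 k2 : nat) (x y t1 t2 : C)
    (A : operator) (p : params) (B : operator) (q : params) : Prop :=
  let F r s1 s2 :=
    appell4 (pa r) (pb r) (pc1 r) (pc2 r) s1 s2 k1 k2 x y in
  let ok r := well_defined (pa r) (pb r) (pc1 r) (pc2 r) t1 t2 k1 k2 in
  ok p -> ok q -> A (F p) t1 t2 - B (F q) t1 t2 = 0.

(* Main.v *)
Require Import Defs.
From Stdlib Require Import Reals Lra.
From Coquelicot Require Import Coquelicot.

Local Open Scope C_scope.

(** The function [t (t-1) ... (t-k+1)], which is [(-1)^k (-t)_k], is an eigenvector
    of [Theta_t] with eigenvalue [k].  Hence [D_1] and [D_2] multiply the term of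
    index [(m, n)] of the series by [m] and by [n], and every operator in the
    relations multiplies it by a polynomial in [m] and [n], its symbol
    ([has_symbol]).

    The algebra then happens in the coefficients.  For each of the eight functions
    [F'] obtained by shifting one parameter of [F] there is a one-step identity
    [al * T' = al' * T] between the terms of [F'] and of [F], for instance
    [a (a+1)_l = (a+l) (a)_l] for [F(a+1)], or
    [(c+m) / (c+1)_m = c / (c)_m] for [F(c+1)] (the lemmas [contiguous_*]).
    The twenty-eight relations are exactly the twenty-eight pairs of these
    identities, cross-multiplied ([relation_at_of_contiguous]).

    Termwise application of the operators needs convergence of the series after
    multiplication by a polynomial, and at the points [t - 1] and [t - 2] where the
    operators evaluate it.  Both come from the openness of the region: absolute
    convergence at a slightly dilated [(x, y)] makes the terms at [(x, y)] summable
    even against a factor [r^(m+n)] with [1 < r] ([well_defined_geom]).  Such a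
    factor absorbs polynomials, and, as [t U(t-1) = (t - m k) U(t)] for a term
    [U], it passes from [t] to [t - 1] as long as [t] is nonzero; when [t = 0] the
    leading factor [t] of [Theta_t] makes the value at [t - 1] irrelevant
    ([theta_expansion]). *)

(** * Double series with geometric slack *)

Lemma box_sum_morph {G H : AbelianMonoid} (h : G -> H) (u : nat -> nat -> G) N :
  (forall p q, h (plus p q) = plus (h p) (h q)) ->
  h (box_sum u N) = box_sum (fun m n => h (u m n)) N.
Proof.
intros hplus.
assert (hsum : forall (v : nat -> G) K, h (sum_n v K) = sum_n (fun i => h (v i)) K).
{ intros v K; induction K as [|K IH]; [now rewrite !sum_O|].
  now rewrite !sum_Sn, hplus, IH. }
unfold box_sum; rewrite hsum; apply sum_n_ext; intros m; apply hsum.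
Qed.

Lemma Re_box_sum (u : nat -> nat -> C) N :
  Re (box_sum u N) = box_sum (fun m n => Re (u m n)) N.
Proof. now apply (box_sum_morph (H := R_AbelianMonoid) Re). Qed.

Lemma Im_box_sum (u : nat -> nat -> C) N :
  Im (box_sum u N) = box_sum (fun m n => Im (u m n)) N.
Proof. now apply (box_sum_morph (H := R_AbelianMonoid) Im). Qed.

Lemma box_sum_ext {G : AbelianMonoid} (u v : nat -> nat -> G) N :
  (forall m n, u m n = v m n) -> box_sum u N = box_sum v N.
Proof.
now intros huv; apply sum_n_ext; intros m; apply sum_n_ext; intros n.
Qed.

(** The equality is taken in [R] rather than in an abstract monoid, so that [ring]
    applies to its summands. *)
Lemma box_sum_ext_R (u v : nat -> nat -> R) N :
  (forall m n, u m n = v m n) -> box_sum u N = box_sum v N.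
Proof. apply box_sum_ext. Qed.

Lemma box_sum_comb (p q : R) (u v : nat -> nat -> R) N :
  box_sum (fun m n => p * u m n + q * v m n)%R N
  = (p * box_sum u N + q * box_sum v N)%R.
Proof.
assert (hsum : forall (f g : nat -> R) K,
  sum_n (fun i => p * f i + q * g i)%R K = (p * sum_n f K + q * sum_n g K)%R).
{ intros f g K; induction K as [|K IH]; [now rewrite !sum_O|].
  rewrite !sum_Sn, IH; unfold plus; simpl; ring. }
unfold box_sum; rewrite <- hsum; apply sum_n_ext; intros m; apply hsum.
Qed.

Lemma box_sum_le (u v : nat -> nat -> R) N :
  (forall m n, u m n <= v m n)%R -> (box_sum u N <= box_sum v N)%R.
Proof.
now intros huv; apply sum_n_m_le; intros m; apply sum_n_m_le; intros n.
Qed.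

Lemma box_sum_incr (u : nat -> nat -> R) N :
  (forall m n, 0 <= u m n)%R -> (box_sum u N <= box_sum u (S N))%R.
Proof.
intros u0.
assert (hpos : forall (f : nat -> R) K, (forall i, 0 <= f i)%R -> (0 <= sum_n f K)%R).
{ intros f K f0; induction K as [|K IH]; [now rewrite sum_O|].
  rewrite sum_Sn; unfold plus; simpl; specialize (f0 (S K)); lra. }
assert (hinc : forall (f : nat -> R) K, (forall i, 0 <= f i)%R ->
  (sum_n f K <= sum_n f (S K))%R).
{ intros f K f0; rewrite sum_Sn; unfold plus; simpl; specialize (f0 (S K)); lra. }
apply Rle_trans with (sum_n (fun m => sum_n (fun n => u m n) (S N)) N).
- now apply sum_n_m_le; intros m; apply hinc.
- now apply hinc; intros m; apply hpos.
Qed.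

(** Splitting [v] as [(v + d) - d] reduces to two nonnegative series. *)
Lemma box_sum_dominated (v d : nat -> nat -> R) (M : R) :
  (forall m n, Rabs (v m n) <= d m n)%R ->
  (forall N, box_sum d N <= M)%R ->
  is_lim_seq (box_sum v) (real (Lim_seq (box_sum v))).
Proof.
intros hvd hM; apply Lim_seq_correct'.
assert (hb : forall m n, (- d m n <= v m n <= d m n)%R).
{ intros m n; apply Rabs_le_between, hvd. }
assert (ed : ex_finite_lim_seq (box_sum d)).
{ apply ex_finite_lim_seq_incr with M; [|easy].
  intros N; apply box_sum_incr; intros m n; specialize (hb m n); lra. }
assert (es : ex_finite_lim_seq (box_sum (fun m n => 1 * v m n + 1 * d m n)%R)).
{ apply ex_finite_lim_seq_incr with (2 * M)%R.
  - intros N; apply box_sum_incr; intros m n; specialize (hb m n); lra.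
  - intros N; apply Rle_trans with (box_sum (fun m n => 1 * d m n + 1 * d m n)%R N).
    + apply box_sum_le; intros m n; specialize (hb m n); lra.
    + rewrite box_sum_comb; specialize (hM N); lra. }
destruct ed as [ld hd], es as [ls hs]; exists (ls - ld)%R.
apply is_lim_seq_ext
  with (fun N => box_sum (fun m n => 1 * v m n + 1 * d m n)%R N - box_sum d N)%R.
- intros N; rewrite box_sum_comb; ring.
- now apply is_lim_seq_minus'.
Qed.

(** Summability with room to spare: unlike plain absolute summability this is
    stable under multiplication by polynomials in [m] and [n], hence under the
    difference operators. *)
Definition geom_summable (u : nat -> nat -> C) : Prop :=
  exists r M : R, (1 < r)%R /\
    forall N, (box_sum (fun m n => r ^ (m + n) * Cmod (u m n)) N <= M)%R.

Lemma pow_ge_1 (r : R) k : (1 < r)%R -> (1 <= r ^ k)%R.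
Proof. intros hr; apply pow_R1_Rle; lra. Qed.

Lemma Rabs_Im_le_Cmod (z : C) : (Rabs (Im z) <= Cmod z)%R.
Proof. apply Rle_trans with (2 := Rmax_Cmod z), Rmax_r. Qed.

Lemma Rabs_Re_le_Cmod (z : C) : (Rabs (Re z) <= Cmod z)%R.
Proof. apply Rle_trans with (2 := Rmax_Cmod z), Rmax_l. Qed.

Lemma double_sum_lim (u : nat -> nat -> C) : geom_summable u ->
  is_lim_seq (box_sum (fun m n => Re (u m n))) (Re (double_sum u)) /\
  is_lim_seq (box_sum (fun m n => Im (u m n))) (Im (double_sum u)).
Proof.
intros (r & M & hr & hM).
assert (hd : forall m n, (Cmod (u m n) <= r ^ (m + n) * Cmod (u m n))%R).
{ intros m n; pose proof (Cmod_ge_0 (u m n)); pose proof (pow_ge_1 r (m + n) hr); nra. }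
split; unfold double_sum; simpl.
- rewrite (Lim_seq_ext _ (box_sum (fun m n => Re (u m n))))
    by (intros N; apply Re_box_sum).
  apply box_sum_dominated with (2 := hM); intros m n.
  apply Rle_trans with (1 := Rabs_Re_le_Cmod _), hd.
- rewrite (Lim_seq_ext _ (box_sum (fun m n => Im (u m n))))
    by (intros N; apply Im_box_sum).
  apply box_sum_dominated with (2 := hM); intros m n.
  apply Rle_trans with (1 := Rabs_Im_le_Cmod _), hd.
Qed.

Lemma double_sum_ext (u v : nat -> nat -> C) :
  (forall m n, u m n = v m n) -> double_sum u = double_sum v.
Proof.
intros huv; unfold double_sum.
f_equal; f_equal; apply Lim_seq_ext; intros N; f_equal; now apply box_sum_ext.
Qed.

Lemma double_sum_unique (u : nat -> nat -> C) (l : C) :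
  is_lim_seq (box_sum (fun m n => Re (u m n))) (Re l) ->
  is_lim_seq (box_sum (fun m n => Im (u m n))) (Im l) ->
  double_sum u = l.
Proof.
intros hre him; unfold double_sum; destruct l as [lr li]; f_equal.
- rewrite (Lim_seq_ext _ (box_sum (fun m n => Re (u m n))))
    by (intros N; apply Re_box_sum).
  now rewrite (is_lim_seq_unique _ _ hre).
- rewrite (Lim_seq_ext _ (box_sum (fun m n => Im (u m n))))
    by (intros N; apply Im_box_sum).
  now rewrite (is_lim_seq_unique _ _ him).
Qed.

Lemma double_sum_scal (z : C) (u : nat -> nat -> C) : geom_summable u ->
  double_sum (fun m n => z * u m n) = z * double_sum u.
Proof.
intros hu; destruct (double_sum_lim u hu) as [hr hi].
apply double_sum_unique.
- rewrite re_mult.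
  apply is_lim_seq_ext with (fun N => Re z * box_sum (fun m n => Re (u m n)) N
     - Im z * box_sum (fun m n => Im (u m n)) N)%R.
  + intros N; transitivity (Re z * box_sum (fun m n => Re (u m n)) N
     + - Im z * box_sum (fun m n => Im (u m n)) N)%R; [ring|].
    rewrite <- box_sum_comb; apply box_sum_ext_R; intros m n; rewrite re_mult; ring.
  + apply is_lim_seq_minus';
      [now apply (is_lim_seq_scal_l _ (Re z) (Re _))
      |now apply (is_lim_seq_scal_l _ (Im z) (Im _))].
- rewrite im_mult.
  apply is_lim_seq_ext with (fun N => Re z * box_sum (fun m n => Im (u m n)) N
     + Im z * box_sum (fun m n => Re (u m n)) N)%R.
  + intros N; rewrite <- box_sum_comb; apply box_sum_ext; intros m n.
    now rewrite im_mult.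
  + apply is_lim_seq_plus';
      [now apply (is_lim_seq_scal_l _ (Re z) (Im _))
      |now apply (is_lim_seq_scal_l _ (Im z) (Re _))].
Qed.

Lemma double_sum_plus (u v : nat -> nat -> C) :
  geom_summable u -> geom_summable v ->
  double_sum (fun m n => u m n + v m n) = double_sum u + double_sum v.
Proof.
intros hu hv.
destruct (double_sum_lim u hu) as [hur hui], (double_sum_lim v hv) as [hvr hvi].
apply double_sum_unique.
- rewrite re_plus; apply is_lim_seq_ext with (2 := is_lim_seq_plus' _ _ _ _ hur hvr).
  intros N; rewrite <- (Rmult_1_l (box_sum (fun m n => Re (u m n)) N)),
    <- (Rmult_1_l (box_sum (fun m n => Re (v m n)) N)), <- box_sum_comb.
  apply box_sum_ext_R; intros m n; rewrite re_plus; ring.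
- rewrite im_plus; apply is_lim_seq_ext with (2 := is_lim_seq_plus' _ _ _ _ hui hvi).
  intros N; rewrite <- (Rmult_1_l (box_sum (fun m n => Im (u m n)) N)),
    <- (Rmult_1_l (box_sum (fun m n => Im (v m n)) N)), <- box_sum_comb.
  apply box_sum_ext_R; intros m n; rewrite im_plus; ring.
Qed.

(** * Weights of subexponential growth *)

Definition subexp (w : nat -> nat -> C) : Prop :=
  forall r : R, (1 < r)%R -> exists K : R, (0 <= K)%R /\
    forall m n, (Cmod (w m n) <= K * r ^ (m + n))%R.

Lemma sqrt_gt_1 r : (1 < r)%R -> (1 < sqrt r)%R.
Proof. intros hr; rewrite <- sqrt_1; apply sqrt_lt_1; lra. Qed.

Lemma sqrt_pow_sqr r k : (1 < r)%R -> (sqrt r ^ k * sqrt r ^ k = r ^ k)%R.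
Proof. intros hr; rewrite <- Rpow_mult_distr, sqrt_sqrt; lra. Qed.

Lemma subexp_const (z : C) : subexp (fun _ _ => z).
Proof.
intros r hr; exists (Cmod z); split; [apply Cmod_ge_0|]; intros m n.
pose proof (pow_ge_1 r (m + n) hr); pose proof (Cmod_ge_0 z); nra.
Qed.

Lemma subexp_plus w w' : subexp w -> subexp w' ->
  subexp (fun m n => w m n + w' m n).
Proof.
intros hw hw' r hr.
destruct (hw r hr) as (K & hK & h), (hw' r hr) as (K' & hK' & h').
exists (K + K')%R; split; [lra|]; intros m n.
apply Rle_trans with (1 := Cmod_triangle _ _).
specialize (h m n); specialize (h' m n); lra.
Qed.

Lemma subexp_mult w w' : subexp w -> subexp w' ->
  subexp (fun m n => w m n * w' m n).
Proof.
intros hw hw' r hr.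
destruct (hw _ (sqrt_gt_1 r hr)) as (K & hK & h).
destruct (hw' _ (sqrt_gt_1 r hr)) as (K' & hK' & h').
exists (K * K')%R; split; [nra|]; intros m n.
rewrite Cmod_mult, <- (sqrt_pow_sqr r (m + n) hr).
replace (K * K' * (sqrt r ^ (m + n) * sqrt r ^ (m + n)))%R
  with (K * sqrt r ^ (m + n) * (K' * sqrt r ^ (m + n)))%R by ring.
apply Rmult_le_compat; auto using Cmod_ge_0.
Qed.

Lemma subexp_ext w w' : (forall m n, w m n = w' m n) -> subexp w -> subexp w'.
Proof.
intros hww hw r hr; destruct (hw r hr) as (K & hK & h); exists K; split; [easy|].
now intros m n; rewrite <- hww.
Qed.

(** Bernoulli's inequality. *)
Lemma INR_le_pow (r : R) k : (1 < r)%R -> (INR k <= / (r - 1) * r ^ k)%R.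
Proof.
intros hr; pose proof (poly k (r - 1) ltac:(lra)) as hB.
replace (1 + (r - 1))%R with r in hB by ring.
apply Rmult_le_reg_l with (r - 1)%R; [lra|].
rewrite <- Rmult_assoc, Rinv_r by lra; lra.
Qed.

Lemma subexp_fst : subexp (fun m _ => INR m).
Proof.
intros r hr; exists (/ (r - 1))%R.
assert (hi : (0 < / (r - 1))%R) by (apply Rinv_0_lt_compat; lra).
split; [lra|]; intros m n.
rewrite Cmod_R, Rabs_pos_eq by apply pos_INR.
apply Rle_trans with (1 := INR_le_pow r m hr), Rmult_le_compat_l; [lra|].
apply Rle_pow; [lra|apply Nat.le_add_r].
Qed.

Lemma subexp_snd : subexp (fun _ n => INR n).
Proof.
intros r hr; exists (/ (r - 1))%R.
assert (hi : (0 < / (r - 1))%R) by (apply Rinv_0_lt_compat; lra).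
split; [lra|]; intros m n.
rewrite Cmod_R, Rabs_pos_eq by apply pos_INR.
apply Rle_trans with (1 := INR_le_pow r n hr), Rmult_le_compat_l; [lra|].
apply Rle_pow; [lra|rewrite Nat.add_comm; apply Nat.le_add_r].
Qed.

(** The ratio [r] is spent in two halves: [sqrt r] bounds the weight and the
    other [sqrt r] remains as the new ratio. *)
Lemma geom_summable_weight w u : subexp w -> geom_summable u ->
  geom_summable (fun m n => w m n * u m n).
Proof.
intros hw (r & M & hr & hM).
destruct (hw _ (sqrt_gt_1 r hr)) as (K & hK & h).
exists (sqrt r), (K * M)%R; split; [now apply sqrt_gt_1|]; intros N.
apply Rle_trans with (K * box_sum (fun m n => r ^ (m + n) * Cmod (u m n))%R N)%R;
  [|now apply Rmult_le_compat_l].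
replace (K * box_sum (fun m n => r ^ (m + n) * Cmod (u m n))%R N)%R with
  (K * box_sum (fun m n => r ^ (m + n) * Cmod (u m n))%R N
   + 0 * box_sum (fun m n => 0)%R N)%R by ring.
rewrite <- box_sum_comb; apply box_sum_le; intros m n.
rewrite Cmod_mult, <- (sqrt_pow_sqr r (m + n) hr).
replace (K * (sqrt r ^ (m + n) * sqrt r ^ (m + n) * Cmod (u m n)) + 0 * 0)%R
  with (sqrt r ^ (m + n) * (K * sqrt r ^ (m + n) * Cmod (u m n)))%R by ring.
apply Rmult_le_compat_l;
  [pose proof (pow_ge_1 _ (m + n) (sqrt_gt_1 r hr)); lra|].
apply Rmult_le_compat_r; [apply Cmod_ge_0|apply h].
Qed.

Lemma geom_summable_ext u v :
  (forall m n, u m n = v m n) -> geom_summable u -> geom_summable v.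
Proof.
intros huv (r & M & hr & hM); exists r, M; split; [easy|]; intros N.
rewrite (box_sum_ext _ (fun m n => (r ^ (m + n) * Cmod (u m n))%R)); [easy|].
now intros m n; rewrite huv.
Qed.

(** * Operators acting as term multipliers *)

(** For a fixed index the function [U . . m n] behaves like the falling
    factorials of degree [m * k1] in the first and [n * k2] in the second
    variable. *)
Definition falling_family (k1 k2 : nat) (U : C -> C -> nat -> nat -> C) : Prop :=
  (forall s1 s2 m n,
    s1 * U (s1 - 1) s2 m n = (s1 - INR m * INR k1) * U s1 s2 m n) /\
  (forall s1 s2 m n,
    s2 * U s1 (s2 - 1) m n = (s2 - INR n * INR k2) * U s1 s2 m n).

(** The equation is restricted to points of summability: elsewhere [double_sum], and
    with it the Appell function, has no meaningful value. *)
Definition expands (U : C -> C -> nat -> nat -> C) (w : nat -> nat -> C)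
    (f : C -> C -> C) : Prop :=
  forall s1 s2, geom_summable (U s1 s2) ->
    f s1 s2 = double_sum (fun m n => w m n * U s1 s2 m n).

(** The quantification over all weights [w] makes symbols multiplicative under
    composition of operators: [B f] has an expansion with the weight of [f] times
    the symbol of [B], while summability is still asked of the bare family [U]. *)
Definition has_symbol (k1 k2 : nat) (A : operator) (p : nat -> nat -> C) : Prop :=
  subexp p /\
  forall U, falling_family k1 k2 U -> forall w f, subexp w -> expands U w f ->
    expands U (fun m n => p m n * w m n) (A f).

Section Symbols.
Variables k1 k2 : nat.
Notation symbol := (has_symbol k1 k2).

Lemma has_symbol_ext A p q :
  symbol A p -> (forall m n, p m n = q m n) -> symbol A q.
Proof.
intros [sp hA] hpq; split; [now apply subexp_ext with p|].
intros U hU w f sw hf s1 s2 hs.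
rewrite (hA U hU w f sw hf s1 s2 hs).
now apply double_sum_ext; intros m n; rewrite hpq.
Qed.

Lemma has_symbol_sc z : symbol (sc z) (fun _ _ => z).
Proof.
split; [apply subexp_const|].
intros U hU w f sw hf s1 s2 hs; unfold sc.
rewrite (hf s1 s2 hs), <- double_sum_scal by now apply geom_summable_weight.
apply double_sum_ext; intros m n; ring.
Qed.

Lemma has_symbol_comp A B p q : symbol A p -> symbol B q ->
  symbol (A * B)%op (fun m n => p m n * q m n).
Proof.
intros [sp hA] [sq hB]; split; [now apply subexp_mult|].
intros U hU w f sw hf s1 s2 hs; unfold op_comp.
assert (sqw : subexp (fun m n => q m n * w m n)) by now apply subexp_mult.
rewrite (hA U hU _ _ sqw (hB U hU w f sw hf) s1 s2 hs).
apply double_sum_ext; intros m n; ring.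
Qed.

Lemma has_symbol_add A B p q : symbol A p -> symbol B q ->
  symbol (A + B)%op (fun m n => p m n + q m n).
Proof.
intros [sp hA] [sq hB]; split; [now apply subexp_plus|].
intros U hU w f sw hf s1 s2 hs; unfold op_add.
rewrite (hA U hU w f sw hf s1 s2 hs), (hB U hU w f sw hf s1 s2 hs).
rewrite <- double_sum_plus
  by (apply geom_summable_weight; [now apply subexp_mult|easy]).
apply double_sum_ext; intros m n; ring.
Qed.

Lemma has_symbol_sub A B p q : symbol A p -> symbol B q ->
  symbol (A - B)%op (fun m n => p m n - q m n).
Proof.
intros hA hB.
destruct (has_symbol_add _ _ _ _ hA (has_symbol_comp _ _ _ _ (has_symbol_sc (- (1))) hB))
  as [sp h].
assert (e : forall m n, p m n + - (1) * q m n = p m n - q m n) by (intros; ring).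
split; [now apply subexp_ext with (2 := sp)|].
intros U hU w f sw hf s1 s2 hs.
transitivity ((A + sc (- (1)) * B)%op f s1 s2).
- unfold op_sub, op_add, op_comp, sc; ring.
- rewrite (h U hU w f sw hf s1 s2 hs).
  now apply double_sum_ext; intros m n; rewrite e.
Qed.

(** Since [s (s-1) ... (s-k+1)] is an eigenvector of [Theta] with eigenvalue [k],
    [Theta] multiplies a falling family by the degree.  The value of the function
    at the shifted point is known only when the shifted series converges, which
    the falling relation gives for [s <> 0]; at [s = 0] the factor [s] in front
    hides that value, and there every term of positive degree vanishes. *)
Lemma theta_expansion (V V' : nat -> nat -> C) (w d : nat -> nat -> C) (s g g' : C) :
  subexp w -> subexp d -> geom_summable V ->
  (forall m n, s * V' m n = (s - d m n) * V m n) ->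
  g = double_sum (fun m n => w m n * V m n) ->
  (geom_summable V' -> g' = double_sum (fun m n => w m n * V' m n)) ->
  s * (g - g') = double_sum (fun m n => d m n * w m n * V m n).
Proof.
intros sw sd hV hVV' hg hg'.
destruct (Ceq_dec s 0) as [->|s0].
- (* here [d m n * V m n] is zero for all [m] and [n] *)
  rewrite Cmult_0_l, <- (Cmult_0_l (double_sum V)), <- double_sum_scal by easy.
  apply double_sum_ext; intros m n; specialize (hVV' m n).
  transitivity (w m n * (0 * V' m n - (0 - d m n) * V m n)); [|ring].
  rewrite hVV'; ring.
- assert (hV' : geom_summable V').
  { apply geom_summable_ext with (fun m n => (1 + - / s * d m n) * V m n).
    - intros m n; transitivity (/ s * (s * V' m n)); [|now field].
      rewrite hVV'; now field.
    - apply geom_summable_weight; [|easy].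
      apply subexp_plus, subexp_mult; auto using subexp_const. }
  rewrite (hg' hV'), hg.
  transitivity (s * double_sum (fun m n => w m n * V m n)
    + (- s) * double_sum (fun m n => w m n * V' m n)); [ring|].
  assert (hwV := geom_summable_weight _ _ sw hV).
  assert (hwV' := geom_summable_weight _ _ sw hV').
  rewrite <- (double_sum_scal s _ hwV), <- (double_sum_scal (- s) _ hwV').
  rewrite <- (double_sum_plus _ _
    (geom_summable_weight _ _ (subexp_const s) hwV)
    (geom_summable_weight _ _ (subexp_const (- s)) hwV')).
  apply double_sum_ext; intros m n.
  transitivity (w m n * (s * V m n - s * V' m n)); [ring|].
  rewrite hVV'; ring.
Qed.

Lemma has_symbol_Theta1 : symbol Theta1 (fun m _ => INR m * INR k1).
Proof.
assert (sd : subexp (fun m _ => INR m * INR k1)).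
{ apply subexp_mult; [apply subexp_fst|apply subexp_const]. }
split; [easy|].
intros U [hU _] w f sw hf s1 s2 hs.
unfold Theta1, op_comp, mul_t1, rho1, Delta1.
replace (s1 - 1 + 1) with s1 by ring.
apply theta_expansion with (V' := U (s1 - 1) s2); auto.
Qed.

Lemma has_symbol_Theta2 : symbol Theta2 (fun _ n => INR n * INR k2).
Proof.
assert (sd : subexp (fun _ n => INR n * INR k2)).
{ apply subexp_mult; [apply subexp_snd|apply subexp_const]. }
split; [easy|].
intros U [_ hU] w f sw hf s1 s2 hs.
unfold Theta2, op_comp, mul_t2, rho2, Delta2.
replace (s2 - 1 + 1) with s2 by ring.
apply theta_expansion with (V' := U s1 (s2 - 1)); auto.
Qed.

Lemma INR_neq_0_C k : (1 <= k)%nat -> RtoC (INR k) <> 0.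
Proof.
intros hk e; apply RtoC_inj in e; apply lt_0_INR in hk; lra.
Qed.

Lemma has_symbol_D1 : (1 <= k1)%nat ->
  symbol (sc (/ INR k1) * Theta1)%op (fun m _ => INR m).
Proof.
intros hk; apply has_symbol_ext
  with (1 := has_symbol_comp _ _ _ _ (has_symbol_sc _) has_symbol_Theta1).
intros m n; field; now apply INR_neq_0_C.
Qed.

Lemma has_symbol_D2 : (1 <= k2)%nat ->
  symbol (sc (/ INR k2) * Theta2)%op (fun _ n => INR n).
Proof.
intros hk; apply has_symbol_ext
  with (1 := has_symbol_comp _ _ _ _ (has_symbol_sc _) has_symbol_Theta2).
intros m n; field; now apply INR_neq_0_C.
Qed.

End Symbols.

(** * The Appell series *)

Lemma poch_pred (a : C) l : (a - 1) * poch a l = (a - 1 + INR l) * poch (a - 1) l.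
Proof.
induction l as [|l IH]; [simpl; ring|].
cbn [poch]; rewrite S_INR, RtoC_plus.
transitivity ((a - 1) * poch a l * (a + INR l)); [ring|].
rewrite IH; ring.
Qed.

Lemma poch_succ (a : C) l : a * poch (a + 1) l = (a + INR l) * poch a l.
Proof.
pose proof (poch_pred (a + 1) l) as h.
now replace (a + 1 - 1) with a in h by ring.
Qed.

(** With [P_K(s) = (-1)^K (-s)_K] this is [s P_K(s-1) = P_(K+1)(s) = (s - K) P_K(s)]. *)
Lemma falling_shift (s : C) K :
  s * ((-1) ^ K * poch (- (s - 1)) K) = (s - INR K) * ((-1) ^ K * poch (- s) K).
Proof.
induction K as [|K IH]; [simpl; ring|].
rewrite !Cpow_S; cbn [poch]; rewrite S_INR, RtoC_plus.
transitivity (s * ((-1) ^ K * poch (- (s - 1)) K) * ((-1) * (- (s - 1) + INR K)));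
  [ring|].
rewrite IH; ring.
Qed.

Lemma falling_family_appell4 a b c1 c2 k1 k2 x y :
  falling_family k1 k2 (fun s1 s2 => appell4_term a b c1 c2 s1 s2 k1 k2 x y).
Proof.
split; intros s1 s2 m n; unfold appell4_term, Cdiv.
- pose proof (falling_shift s1 (m * k1)) as h.
  rewrite mult_INR, RtoC_mult in h.
  set (P := (-1) ^ (m * k1) * poch (- (s1 - 1)) (m * k1)) in *.
  set (Q := (-1) ^ (m * k1) * poch (- s1) (m * k1)) in *.
  set (Z := / _).
  transitivity (s1 * P * (poch a (m + n) * poch b (m + n) *
    ((-1) ^ (n * k2) * poch (- s2) (n * k2)) * Z * x ^ m * y ^ n)); [ring|].
  rewrite h; ring.
- pose proof (falling_shift s2 (n * k2)) as h.
  rewrite mult_INR, RtoC_mult in h.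
  set (P := (-1) ^ (n * k2) * poch (- (s2 - 1)) (n * k2)) in *.
  set (Q := (-1) ^ (n * k2) * poch (- s2) (n * k2)) in *.
  set (Z := / _).
  transitivity (s2 * P * (poch a (m + n) * poch b (m + n) *
    ((-1) ^ (m * k1) * poch (- s1) (m * k1)) * Z * x ^ m * y ^ n)); [ring|].
  rewrite h; ring.
Qed.

(** The region is open, so the series still converges absolutely at a dilate
    [(r x, r y)] with [1 < r]; there the terms carry the extra factor
    [r ^ (m + n)]. *)
Lemma well_defined_geom a b c1 c2 t1 t2 k1 k2 x y :
  region x y -> well_defined a b c1 c2 t1 t2 k1 k2 ->
  geom_summable (appell4_term a b c1 c2 t1 t2 k1 k2 x y).
Proof.
intros hxy (_ & _ & hs).
set (s := (sqrt (Cmod x) + sqrt (Cmod y))%R).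
assert (hs1 : (s < 1)%R) by exact hxy.
assert (hs0 : (0 <= s)%R).
{ apply Rplus_le_le_0_compat; apply sqrt_pos. }
(* [q * s = 2 s / (1 + s) < 1] *)
set (q := (2 / (1 + s))%R).
assert (hq : (1 < q)%R).
{ unfold q; apply Rmult_lt_reg_r with (1 + s)%R; [lra|].
  unfold Rdiv; rewrite Rmult_assoc, Rinv_l; lra. }
assert (hqs : (q * s < 1)%R).
{ unfold q; apply Rmult_lt_reg_r with (1 + s)%R; [lra|].
  replace (2 / (1 + s) * s * (1 + s))%R with (2 * s)%R by (field; lra); lra. }
assert (hr : (1 < q * q)%R) by nra.
assert (hreg : region (RtoC (q * q) * x) (RtoC (q * q) * y)).
{ unfold region; rewrite !Cmod_mult, Cmod_R, Rabs_pos_eq by lra.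
  rewrite !sqrt_mult, sqrt_sqrt by (lra || apply Cmod_ge_0).
  fold s; unfold s in hqs; lra. }
destruct (hs _ _ hreg) as [l hl].
exists (q * q)%R, l; split; [easy|]; intros N.
rewrite (box_sum_ext_R _ (fun m n => Cmod (appell4_term a b c1 c2 t1 t2 k1 k2
  (RtoC (q * q) * x) (RtoC (q * q) * y) m n))).
- apply is_lim_seq_incr_compare with (1 := hl).
  intros K; apply box_sum_incr; intros m n; apply Cmod_ge_0.
- intros m n; unfold appell4_term; rewrite !Cpow_mult_l, <- !RtoC_pow.
  rewrite pow_add, !Cmod_mult, !Cmod_R, !(Rabs_pos_eq (_ ^ _))
    by (apply pow_le; lra); ring.
Qed.

Definition term_of (r : params) (t1 t2 : C) (k1 k2 : nat) (x y : C) :=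
  appell4_term (pa r) (pb r) (pc1 r) (pc2 r) t1 t2 k1 k2 x y.

(** An operator with a symbol may be applied term by term, so a relation between
    two functions is an identity between the terms of their series. *)
Lemma relation_at_of_terms k1 k2 x y t1 t2 A p B q al be :
  region x y -> has_symbol k1 k2 A al -> has_symbol k1 k2 B be ->
  (lower_ok (pc1 p) -> lower_ok (pc2 p) -> lower_ok (pc1 q) -> lower_ok (pc2 q) ->
   forall m n, al m n * term_of p t1 t2 k1 k2 x y m n
             = be m n * term_of q t1 t2 k1 k2 x y m n) ->
  relation_at k1 k2 x y t1 t2 A p B q.
Proof.
intros hxy [_ hA] [_ hB] hterm okp okq.
assert (hF : forall r, expands (fun s1 s2 => term_of r s1 s2 k1 k2 x y) (fun _ _ => 1)
  (fun s1 s2 => appell4 (pa r) (pb r) (pc1 r) (pc2 r) s1 s2 k1 k2 x y)).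
{ intros r s1 s2 _; apply double_sum_ext; intros m n; unfold term_of; ring. }
rewrite (hA _ (falling_family_appell4 _ _ _ _ _ _ _ _) _ _ (subexp_const 1) (hF p)
  t1 t2 (well_defined_geom _ _ _ _ _ _ _ _ _ _ hxy okp)).
rewrite (hB _ (falling_family_appell4 _ _ _ _ _ _ _ _) _ _ (subexp_const 1) (hF q)
  t1 t2 (well_defined_geom _ _ _ _ _ _ _ _ _ _ hxy okq)).
destruct okp as (p1 & p2 & _), okq as (q1 & q2 & _).
rewrite (double_sum_ext _ (fun m n => be m n * 1 * term_of q t1 t2 k1 k2 x y m n));
  [apply Cplus_opp_r|].
intros m n; specialize (hterm p1 p2 q1 q2 m n).
transitivity (al m n * term_of p t1 t2 k1 k2 x y m n); [unfold term_of; ring|].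
rewrite hterm; ring.
Qed.

(** This gives [lower_ok c1] and [lower_ok c2] in every relation, although the
    unshifted function need not occur there: of the two functions related, one
    keeps the parameter or lowers it. *)
Lemma lower_ok_pred c : lower_ok (c - 1) -> lower_ok c.
Proof.
intros h n e; apply (h (S n)); rewrite S_INR; unfold Cminus.
rewrite re_plus, re_opp, e; simpl; lra.
Qed.

Lemma lower_ok_add_neq_0 c n : lower_ok c -> c + INR n <> 0.
Proof.
intros h e; apply (h n); apply (f_equal Re) in e.
rewrite re_plus, !re_RtoC in e; lra.
Qed.

Lemma poch_neq_0 c n : lower_ok c -> poch c n <> 0.
Proof.
intros h; induction n as [|n IH]; simpl.
- intros e; apply RtoC_inj in e; lra.
- now apply Cmult_neq_0; [|apply lower_ok_add_neq_0].
Qed.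

Lemma inv_poch_succ c m : lower_ok c -> lower_ok (c + 1) ->
  (c + INR m) / poch (c + 1) m = c / poch c m.
Proof.
intros h h1; pose proof (poch_succ c m) as e.
pose proof (poch_neq_0 c m h); pose proof (poch_neq_0 (c + 1) m h1).
transitivity ((c + INR m) * poch c m / (poch c m * poch (c + 1) m)); [now field|].
rewrite <- e; now field.
Qed.

Lemma inv_poch_pred c m : lower_ok (c - 1) ->
  (c - 1) / poch (c - 1) m = (c + INR m - 1) / poch c m.
Proof.
intros h; pose proof (inv_poch_succ (c - 1) m) as e.
replace (c - 1 + 1) with c in e by ring.
rewrite <- e by auto using lower_ok_pred; f_equal; ring.
Qed.

(** * Contiguous parameters *)

Section Contiguity.
Variables (k1 k2 : nat) (a b c1 c2 t1 t2 x y : C).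
Notation T r := (term_of r t1 t2 k1 k2 x y).

Definition contiguous (p : params) (al al' : nat -> nat -> C) : Prop :=
  forall m n, al m n * T p m n = al' m n * T (Params a b c1 c2) m n.

Lemma contiguous_a_succ :
  contiguous (Params (a + 1) b c1 c2) (fun _ _ => a) (fun m n => a + INR m + INR n).
Proof.
intros m n; unfold term_of, appell4_term, Cdiv; cbn [pa pb pc1 pc2].
pose proof (poch_succ a (m + n)) as h; rewrite plus_INR, RtoC_plus in h.
set (Z := / _).
transitivity (a * poch (a + 1) (m + n) * (poch b (m + n)
  * ((-1) ^ (m * k1) * poch (- t1) (m * k1))
  * ((-1) ^ (n * k2) * poch (- t2) (n * k2)) * Z * x ^ m * y ^ n)); [ring|].
rewrite h; ring.
Qed.

Lemma contiguous_a_pred :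
  contiguous (Params (a - 1) b c1 c2)
    (fun m n => a + INR m + INR n - 1) (fun _ _ => a - 1).
Proof.
intros m n; unfold term_of, appell4_term, Cdiv; cbn [pa pb pc1 pc2].
pose proof (poch_pred a (m + n)) as h; rewrite plus_INR, RtoC_plus in h.
set (Z := / _).
transitivity ((a - 1 + (INR m + INR n)) * poch (a - 1) (m + n) * (poch b (m + n)
  * ((-1) ^ (m * k1) * poch (- t1) (m * k1))
  * ((-1) ^ (n * k2) * poch (- t2) (n * k2)) * Z * x ^ m * y ^ n)); [ring|].
rewrite <- h; ring.
Qed.

Lemma INR_fact_neq_0_C n : RtoC (INR (Factorial.fact n)) <> 0.
Proof. intros e; apply RtoC_inj in e; now apply (INR_fact_neq_0 n). Qed.

Lemma appell4_term_split a' b' c1' c2' m n : lower_ok c1' -> lower_ok c2' ->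
  appell4_term a' b' c1' c2' t1 t2 k1 k2 x y m n
  = / poch c1' m * (/ poch c2' n *
    (poch a' (m + n) * poch b' (m + n)
      * ((-1) ^ (m * k1) * poch (- t1) (m * k1))
      * ((-1) ^ (n * k2) * poch (- t2) (n * k2))
      / INR (Factorial.fact m) / INR (Factorial.fact n) * x ^ m * y ^ n)).
Proof.
intros h1 h2; unfold appell4_term.
pose proof (INR_fact_neq_0_C m); pose proof (INR_fact_neq_0_C n).
pose proof (poch_neq_0 c1' m h1); pose proof (poch_neq_0 c2' n h2).
now field.
Qed.

Lemma contiguous_c1_succ : lower_ok c1 -> lower_ok (c1 + 1) -> lower_ok c2 ->
  contiguous (Params a b (c1 + 1) c2) (fun m _ => c1 + INR m) (fun _ _ => c1).
Proof.
intros h1 h1' h2 m n; unfold term_of; cbn [pa pb pc1 pc2].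
rewrite !appell4_term_split by assumption; rewrite !Cmult_assoc.
change ((c1 + INR m) * / poch (c1 + 1) m) with ((c1 + INR m) / poch (c1 + 1) m).
now rewrite inv_poch_succ.
Qed.

Lemma contiguous_c1_pred : lower_ok c1 -> lower_ok (c1 - 1) -> lower_ok c2 ->
  contiguous (Params a b (c1 - 1) c2) (fun _ _ => c1 - 1) (fun m _ => c1 + INR m - 1).
Proof.
intros h1 h1' h2 m n; unfold term_of; cbn [pa pb pc1 pc2].
rewrite !appell4_term_split by assumption; rewrite !Cmult_assoc.
change ((c1 - 1) * / poch (c1 - 1) m) with ((c1 - 1) / poch (c1 - 1) m).
now rewrite inv_poch_pred.
Qed.

Lemma contiguous_c2_succ : lower_ok c1 -> lower_ok c2 -> lower_ok (c2 + 1) ->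
  contiguous (Params a b c1 (c2 + 1)) (fun _ n => c2 + INR n) (fun _ _ => c2).
Proof.
intros h1 h2 h2' m n; unfold term_of; cbn [pa pb pc1 pc2].
rewrite !appell4_term_split, !(Cmult_assoc (/ poch c1 m)),
  !(Cmult_comm (/ poch c1 m)), !Cmult_assoc by assumption.
change ((c2 + INR n) * / poch (c2 + 1) n) with ((c2 + INR n) / poch (c2 + 1) n).
now rewrite inv_poch_succ.
Qed.

Lemma contiguous_c2_pred : lower_ok c1 -> lower_ok c2 -> lower_ok (c2 - 1) ->
  contiguous (Params a b c1 (c2 - 1)) (fun _ _ => c2 - 1) (fun _ n => c2 + INR n - 1).
Proof.
intros h1 h2 h2' m n; unfold term_of; cbn [pa pb pc1 pc2].
rewrite !appell4_term_split, !(Cmult_assoc (/ poch c1 m)),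
  !(Cmult_comm (/ poch c1 m)), !Cmult_assoc by assumption.
change ((c2 - 1) * / poch (c2 - 1) n) with ((c2 - 1) / poch (c2 - 1) n).
now rewrite inv_poch_pred.
Qed.

(** Cross-multiplication through the term with parameters [a, b, c1, c2].  It is done
    term by term because the intermediate series itself may diverge. *)
Lemma relation_at_of_contiguous A p B q al al' be be' :
  region x y ->
  (lower_ok (pc1 p) -> lower_ok (pc2 p) -> lower_ok (pc1 q) -> lower_ok (pc2 q) ->
   contiguous p al al' /\ contiguous q be be') ->
  has_symbol k1 k2 A (fun m n => be' m n * al m n) ->
  has_symbol k1 k2 B (fun m n => al' m n * be m n) ->
  relation_at k1 k2 x y t1 t2 A p B q.
Proof.
intros hxy hpq hA hB; apply relation_at_of_terms with (2 := hA) (3 := hB); [easy|].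
intros p1 p2 q1 q2 m n; destruct (hpq p1 p2 q1 q2) as [hp hq].
rewrite <- !Cmult_assoc, hp, hq; ring.
Qed.

End Contiguity.

Section ContiguityB.
Variables (k1 k2 : nat) (a b c1 c2 t1 t2 x y : C).

(** The terms are symmetric in [a] and [b]. *)
Lemma contiguous_swap b' al al' :
  contiguous k1 k2 b a c1 c2 t1 t2 x y (Params b' a c1 c2) al al' ->
  contiguous k1 k2 a b c1 c2 t1 t2 x y (Params a b' c1 c2) al al'.
Proof.
assert (hT : forall d e m n, term_of (Params d e c1 c2) t1 t2 k1 k2 x y m n
  = term_of (Params e d c1 c2) t1 t2 k1 k2 x y m n).
{ intros d e m n; unfold term_of, appell4_term; cbn [pa pb pc1 pc2].
  now rewrite (Cmult_comm (poch d (m + n))). }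
intros h m n; rewrite (hT a b'), (hT a b); apply h.
Qed.

Lemma contiguous_b_succ :
  contiguous k1 k2 a b c1 c2 t1 t2 x y (Params a (b + 1) c1 c2)
    (fun _ _ => b) (fun m n => b + INR m + INR n).
Proof. apply contiguous_swap, contiguous_a_succ. Qed.

Lemma contiguous_b_pred :
  contiguous k1 k2 a b c1 c2 t1 t2 x y (Params a (b - 1) c1 c2)
    (fun m n => b + INR m + INR n - 1) (fun _ _ => b - 1).
Proof. apply contiguous_swap, contiguous_a_pred. Qed.

End ContiguityB.

(** * The twenty-eight relations *)

Ltac find_symbol :=
  lazymatch goal with
  | |- has_symbol _ _ (sc _) _ => apply has_symbol_sc
  | |- has_symbol _ _ (_ * _)%op _ => eapply has_symbol_comp; find_symbol
  | |- has_symbol _ _ (_ + _)%op _ => eapply has_symbol_add; find_symbol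
  | |- has_symbol _ _ (_ - _)%op _ => eapply has_symbol_sub; find_symbol
  | |- _ => eassumption
  end.

Ltac cross hp hq :=
  eapply relation_at_of_contiguous;
  [ assumption
  | cbn [pc1 pc2]; intros; split;
    [ apply hp; auto using lower_ok_pred | apply hq; auto using lower_ok_pred ]
  | eapply has_symbol_ext; [find_symbol | intros m n; cbn beta; ring]
  | eapply has_symbol_ext; [find_symbol | intros m n; cbn beta; ring] ].

Theorem mainTheorem7 (k1 k2 : nat) (hk1 : (1 <= k1)%nat) (hk2 : (1 <= k2)%nat)
    (a b c1 c2 t1 t2 x y : C) (hxy : region x y) :
  let D1 := (sc (/ INR k1) * Theta1)%op in
  let D2 := (sc (/ INR k2) * Theta2)%op in
  let ap := Params (a + 1) b c1 c2 in
  let am := Params (a - 1) b c1 c2 in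
  let bp := Params a (b + 1) c1 c2 in
  let bm := Params a (b - 1) c1 c2 in
  let c1p := Params a b (c1 + 1) c2 in
  let c1m := Params a b (c1 - 1) c2 in
  let c2p := Params a b c1 (c2 + 1) in
  let c2m := Params a b c1 (c2 - 1) in
  let rel := relation_at k1 k2 x y t1 t2 in
  rel (sc a * sc (a - 1))%op ap
      ((sc a + D1 + D2) * (sc a + D1 + D2 - sc 1))%op am /\
  rel (sc a * sc (b - 1))%op ap
      ((sc a + D1 + D2) * (sc b + D1 + D2 - sc 1))%op bm /\
  rel (sc a * sc c1)%op ap
      ((sc a + D1 + D2) * (sc c1 + D1))%op c1p /\
  rel (sc a * sc c2)%op ap
      ((sc a + D1 + D2) * (sc c2 + D2))%op c2p /\
  rel (sc a * (sc b + D1 + D2))%op ap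
      (sc b * (sc a + D1 + D2))%op bp /\
  rel (sc a * (sc c1 + D1 - sc 1))%op ap
      (sc (c1 - 1) * (sc a + D1 + D2))%op c1m /\
  rel (sc a * (sc c2 + D2 - sc 1))%op ap
      (sc (c2 - 1) * (sc a + D1 + D2))%op c2m /\
  rel ((sc a + D1 + D2 - sc 1) * (sc b + D1 + D2))%op am
      (sc b * sc (a - 1))%op bp /\
  rel ((sc a + D1 + D2 - sc 1) * (sc c1 + D1 - sc 1))%op am
      (sc (c1 - 1) * sc (a - 1))%op c1m /\
  rel ((sc a + D1 + D2 - sc 1) * (sc c2 + D2 - sc 1))%op am
      (sc (c2 - 1) * sc (a - 1))%op c2m /\
  rel (sc (b - 1) * (sc a + D1 + D2 - sc 1))%op am
      (sc (a - 1) * (sc b + D1 + D2 - sc 1))%op bm /\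
  rel (sc c1 * (sc a + D1 + D2 - sc 1))%op am
      (sc (a - 1) * (sc c1 + D1))%op c1p /\
  rel (sc c2 * (sc a + D1 + D2 - sc 1))%op am
      (sc (a - 1) * (sc c2 + D2))%op c2p /\
  rel (sc b * sc (b - 1))%op bp
      ((sc b + D1 + D2) * (sc b + D1 + D2 - sc 1))%op bm /\
  rel (sc b * (sc c1 + D1 - sc 1))%op bp
      (sc (c1 - 1) * (sc b + D1 + D2))%op c1m /\
  rel (sc b * (sc c2 + D2 - sc 1))%op bp
      (sc (c2 - 1) * (sc b + D1 + D2))%op c2m /\
  rel (sc b * sc c1)%op bp
      ((sc c1 + D1) * (sc b + D1 + D2))%op c1p /\
  rel (sc b * sc c2)%op bp
      ((sc c2 + D2) * (sc b + D1 + D2))%op c2p /\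
  rel ((sc b + D1 + D2 - sc 1) * (sc c1 + D1 - sc 1))%op bm
      (sc (c1 - 1) * sc (b - 1))%op c1m /\
  rel ((sc b + D1 + D2 - sc 1) * (sc c2 + D2 - sc 1))%op bm
      (sc (c2 - 1) * sc (b - 1))%op c2m /\
  rel (sc c1 * (sc b + D1 + D2 - sc 1))%op bm
      (sc (b - 1) * (sc c1 + D1))%op c1p /\
  rel (sc c2 * (sc b + D1 + D2 - sc 1))%op bm
      (sc (b - 1) * (sc c2 + D2))%op c2p /\
  rel (sc c1 * sc (c1 - 1))%op c1m
      ((sc c1 + D1 - sc 1) * (sc c1 + D1))%op c1p /\
  rel (sc (c1 - 1) * (sc c2 + D2 - sc 1))%op c1m
      (sc (c2 - 1) * (sc c1 + D1 - sc 1))%op c2m /\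
  rel (sc c2 * sc (c1 - 1))%op c1m
      ((sc c1 + D1 - sc 1) * (sc c2 + D2))%op c2p /\
  rel ((sc c1 + D1) * (sc c2 + D2 - sc 1))%op c1p
      (sc c1 * sc (c2 - 1))%op c2m /\
  rel (sc c2 * (sc c1 + D1))%op c1p
      (sc c1 * (sc c2 + D2))%op c2p /\
  rel (sc c2 * sc (c2 - 1))%op c2m
      ((sc c2 + D2 - sc 1) * (sc c2 + D2))%op c2p.
Proof.
intros D1 D2 ap am bp bm c1p c1m c2p c2m rel.
assert (hD1 := has_symbol_D1 k1 k2 hk1); fold D1 in hD1; clearbody D1.
assert (hD2 := has_symbol_D2 k1 k2 hk2); fold D2 in hD2; clearbody D2.
unfold rel, ap, am, bp, bm, c1p, c1m, c2p, c2m; clear rel ap am bp bm c1p c1m c2p c2m.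
repeat apply conj.
- cross contiguous_a_succ contiguous_a_pred.
- cross contiguous_a_succ contiguous_b_pred.
- cross contiguous_a_succ contiguous_c1_succ.
- cross contiguous_a_succ contiguous_c2_succ.
- cross contiguous_a_succ contiguous_b_succ.
- cross contiguous_a_succ contiguous_c1_pred.
- cross contiguous_a_succ contiguous_c2_pred.
- cross contiguous_a_pred contiguous_b_succ.
- cross contiguous_a_pred contiguous_c1_pred.
- cross contiguous_a_pred contiguous_c2_pred.
- cross contiguous_a_pred contiguous_b_pred.
- cross contiguous_a_pred contiguous_c1_succ.
- cross contiguous_a_pred contiguous_c2_succ.
- cross contiguous_b_succ contiguous_b_pred.
- cross contiguous_b_succ contiguous_c1_pred.
- cross contiguous_b_succ contiguous_c2_pred.
- cross contiguous_b_succ contiguous_c1_succ.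
- cross contiguous_b_succ contiguous_c2_succ.
- cross contiguous_b_pred contiguous_c1_pred.
- cross contiguous_b_pred contiguous_c2_pred.
- cross contiguous_b_pred contiguous_c1_succ.
- cross contiguous_b_pred contiguous_c2_succ.
- cross contiguous_c1_pred contiguous_c1_succ.
- cross contiguous_c1_pred contiguous_c2_pred.
- cross contiguous_c1_pred contiguous_c2_succ.
- cross contiguous_c1_succ contiguous_c2_pred.
- cross contiguous_c1_succ contiguous_c2_succ.
- cross contiguous_c2_pred contiguous_c2_succ.
Qed.
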